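(* Let $q$ be a power of a prime, let $J$ be a finite-dimensional, associative, nilpotent $\mathbb{F}_q$-algebra, let $G=1+J$ be the corresponding algebra group, and let $\mathsf{S}$ be the double orbit supercharacter theory of $G$. Then the following hold. (1) For each $i\ge1$, $\gamma_i(\mathsf{S})=1+J^i$. (2) For each $i\ge0$, $\zeta_i(\mathsf{S})=1+\mathrm{Ann}_i(J)$.
   Context: Given a finite-dimensional, associative, nilpotent $\mathbb{F}_q$-algebra $J$, let $A=\mathbb{F}_q+J$ be the unital algebra obtained by adjoining an identity. The set $G=1+J=\{1+x:x\in J\}$ is a subgroup of the unit group of $A$, called an ($\mathbb{F}_q$-)algebra group. The sets $K_g=\{1+x(g-1)y:x,y\in G\}$, $g\in G$, partition $G$. A supercharacter theory of a finite group $G$ is a pair consisting of a partition $\mathcal{X}$ of the set $\mathrm{Irr}(G)$ of complex irreducible characters and a partition $\mathcal{K}$ of $G$ (whose parts are called superclasses, or $\mathsf{S}$-classes) such that $\{1\}\in\mathcal{K}$, $|\mathcal{X}|=|\mathcal{K}|$, and for each $X\in\mathcal{X}$ there is a (nonzero) character with constituents in $X$ that is constant on the parts of $\mathcal{K}$; it is determined by $\mathcal{K}$. It is known (Diaconis--Isaacs) that the sets $K_g$ are the superclasses of a supercharacter theory $\mathsf{S}$ of $G=1+J$, called the double orbit supercharacter theory. For a supercharacter theory $\mathsf{S}$ of a finite group $G$, $\mathrm{cl}_{\mathsf{S}}(g)$ is the $\mathsf{S}$-class of $g$, a subgroup is $\mathsf{S}$-normal if it is a union of $\mathsf{S}$-classes,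 $\mathbf{Z}(\mathsf{S})=\{g\in G:|\mathrm{cl}_{\mathsf{S}}(g)|=1\}$, and for $H\le G$, $[H,\mathsf{S}]=\langle g^{-1}k:g\in H,\ k\in\mathrm{cl}_{\mathsf{S}}(g)\rangle$. For $N$ $\mathsf{S}$-normal, $\mathsf{S}^{G/N}$ is the supercharacter theory of $G/N$ whose classes are the images of the $\mathsf{S}$-classes under $G\to G/N$. The lower $\mathsf{S}$-central series is defined by $\gamma_1(\mathsf{S})=G$ and $\gamma_i(\mathsf{S})=[\gamma_{i-1}(\mathsf{S}),\mathsf{S}]$ for $i\ge2$; the upper $\mathsf{S}$-central series is defined by $\zeta_0(\mathsf{S})=1$ and $\zeta_i(\mathsf{S})/\zeta_{i-1}(\mathsf{S})=\mathbf{Z}(\mathsf{S}^{G/\zeta_{i-1}(\mathsf{S})})$ for $i\ge1$. For a nilpotent algebra $J$, $\mathrm{Ann}(J)=\{x\in J: xJ=Jx=0\}$ is the two-sided annihilator. The upper annihilator series is defined by $\mathrm{Ann}_0(J)=0$ and $\mathrm{Ann}_{i+1}(J)/\mathrm{Ann}_i(J)=\mathrm{Ann}(J/\mathrm{Ann}_i(J))$; the lower annihilator series is $J\supseteq J^2\supseteq J^3\supseteq\dotsb$. *)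

(* Defs.v *)
From HB Require Import structures.
From mathcomp Require Import all_boot all_order all_fingroup all_algebra.
From mathcomp Require Import all_solvable all_field all_character.

Set Implicit Arguments.
Unset Strict Implicit.
Unset Printing Implicit Defensive.

Import GroupScope GRing.Theory.
Local Open Scope ring_scope.

HB.mixin Record Vector_isNonUnitalAlgebra (F : fieldType) J of Vector F J := {
  numul : J -> J -> J;
  numulA : associative numul;
  numulDl : left_distributive numul +%R;
  numulDr : right_distributive numul +%R;
  numulZl : forall (a : F) (x y : J), numul (a *: x) y = a *: numul x y;
  numulZr : forall (a : F) (x y : J), numul x (a *: y) = a *: numul x y
}.

#[short(type="nonUnitalAlgType")]
HB.structure Definition NonUnitalAlgebra (F : fieldType) :=
  { J of Vector F J & Vector_isNonUnitalAlgebra F J }.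

(* The unital algebra F + J: the pair (a, x) stands for a 1 + x.  F^o is F seen
   as a vector space over itself. *)
Definition adjoin1 (F : fieldType) (J : nonUnitalAlgType F) : Type :=
  (F^o * J)%type.

Section Adjoin1.
Variables (F : fieldType) (J : nonUnitalAlgType F).
Local Notation A := (adjoin1 J).

HB.instance Definition _ := Vector.copy A (F^o * J)%type.

Definition adjoin1_one : A := (1, 0).
Definition adjoin1_mul (u v : A) : A :=
  let: (a, x) := u in let: (b, y) := v in
  ((a : F) * b, (a : F) *: y + (b : F) *: x + numul x y).

Fact numul0x (x : J) : numul 0 x = 0.
Proof. by rewrite -[X in numul X](scale0r 0) numulZl scale0r. Qed.

Fact numulx0 (x : J) : numul x 0 = 0.
Proof. by rewrite -[X in numul _ X](scale0r 0) numulZr scale0r. Qed.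

Fact adjoin1_mulA : associative adjoin1_mul.
Proof.
move=> [a x] [b y] [c z]; congr (_, _) => /=; first exact: mulrA.
rewrite !scalerDr !numulDl !numulDr !numulZl !numulZr !scalerA numulA.
rewrite [c * a]mulrC [c * b]mulrC !addrA.
by rewrite [RHS](ACl (1 * 2 * 5 * 3 * 6 * 4 * 7))%AC.
Qed.

Fact adjoin1_mul1x : left_id adjoin1_one adjoin1_mul.
Proof.
by move=> [a x]; congr (_, _); rewrite /= ?mul1r // numul0x scaler0 scale1r !addr0.
Qed.

Fact adjoin1_mulx1 : right_id adjoin1_one adjoin1_mul.
Proof.
by move=> [a x]; congr (_, _);
  rewrite /= ?mulr1 // numulx0 scaler0 scale1r add0r addr0.
Qed.

Fact adjoin1_mulDl : left_distributive adjoin1_mul +%R.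
Proof.
move=> [a x] [b y] [c z]; congr (_, _) => /=; first exact: mulrDl.
by rewrite numulDl scalerDl scalerDr [RHS]addrACA; congr (_ + _); apply: addrACA.
Qed.

Fact adjoin1_mulDr : right_distributive adjoin1_mul +%R.
Proof.
move=> [a x] [b y] [c z]; congr (_, _) => /=; first exact: mulrDr.
by rewrite numulDr scalerDl scalerDr [RHS]addrACA; congr (_ + _); apply: addrACA.
Qed.

Fact adjoin1_one_neq0 : adjoin1_one != 0.
Proof. by apply/eqP=> -[] /eqP; rewrite oner_eq0. Qed.

HB.instance Definition _ := GRing.Zmodule_isNzRing.Build A
  adjoin1_mulA adjoin1_mul1x adjoin1_mulx1 adjoin1_mulDl adjoin1_mulDr
  adjoin1_one_neq0.

Fact adjoin1_scaleAl (a : F) (u v : A) : a *: (u * v) = (a *: u) * v.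
Proof.
case: u v => [b x] [c y]; congr (_, _) => /=; first exact: mulrA.
by rewrite !scalerDr numulZl !scalerA [c * a]mulrC.
Qed.

HB.instance Definition _ := GRing.Lmodule_isLalgebra.Build F A adjoin1_scaleAl.

Fact adjoin1_scaleAr (a : F) (u v : A) : a *: (u * v) = u * (a *: v).
Proof.
case: u v => [b x] [c y]; congr (_, _) => /=; first exact: mulrCA.
by rewrite !scalerDr numulZr !scalerA [b * a]mulrC.
Qed.

HB.instance Definition _ := GRing.Lalgebra_isAlgebra.Build F A adjoin1_scaleAr.
HB.instance Definition _ := Algebra_isFalgebra.Build F A.

Definition in_adjoin1 (x : J) : A := (0, x).

Fact in_adjoin1_is_linear : linear in_adjoin1.
Proof. by move=> a x y; congr (_, _); rewrite /= scaler0 addr0. Qed.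

HB.instance Definition _ :=
  GRing.isLinear.Build F J A *:%R in_adjoin1 in_adjoin1_is_linear.

(* J as a subspace of F + J; its powers are (idealv J ^+ i)%VS, where
   (U ^+ i)%VS is the span of the products of i elements of U. *)
Definition idealv : {vspace A} := limg (linfun in_adjoin1).

Fact mem_idealv (u : A) : (u \in idealv) = (u.1 == 0).
Proof.
apply/memv_imgP/eqP => [[x _ ->]|]; first by rewrite lfunE.
by case: u => a x /= ->; exists x; rewrite ?memvf // lfunE.
Qed.

Definition nilpotent_algebra : Prop := exists n, (idealv ^+ n)%VS = 0%VS.

End Adjoin1.

Section AlgebraGroup.
Variables (F : finFieldType) (J : nonUnitalAlgType F).

(* finvect_type only adds the finite type structure: F is finite. *)
Local Notation A := (finvect_type (adjoin1 J)).

(* The set 1 + X, for X contained in J.  When J is nilpotent every element of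
   1 + J is a unit, so restricting to units of F + J loses nothing: see
   one_plus_unit. *)
Definition one_plus (X : {pred A}) : {set {unit A}} :=
  [set u : {unit A} | val u - 1 \in X].

Fact one_plus_unit (x : A) :
  nilpotent_algebra J -> x \in idealv J -> 1 + x \in GRing.unit.
Proof.
case=> n Jn0 Jx; have xn0: (- x) ^+ n = 0.
  apply/eqP; rewrite -memv0 -Jn0; have {}Jx: - x \in idealv J by rewrite memvN.
  elim: n {Jn0} => [|n IHn]; first by rewrite expr0 expv0 memv_line.
  by rewrite exprS expvSl memv_mul.
apply/unitrP; exists (\sum_(i < n) (- x) ^+ i).
have e1: (1 + x) * (\sum_(i < n) (- x) ^+ i) = 1.
  have := subrX1 (- x) n; rewrite xn0 sub0r -opprD mulNr => /oppr_inj e.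
  by rewrite [1 + x]addrC; apply/esym.
split=> //; rewrite -[RHS]e1; apply/esym/commr_sum => i _.
by apply/commrX/commrN; rewrite /GRing.comm mulrDl mulrDr mul1r mulr1.
Qed.

Fact one_plus_group_set : group_set (one_plus (idealv J)).
Proof.
apply/group_setP; split=> [|u v]; rewrite !inE; first by rewrite subrr mem0v.
rewrite !mem_idealv /= => /eqP/subr0_eq u1 /eqP/subr0_eq v1; apply/eqP.
case: (FinRing.uval u : adjoin1 J) u1 => a x /= ->.
by case: (FinRing.uval v : adjoin1 J) v1 => b y /= ->; rewrite mulr1 subrr.
Qed.

Definition algebra_group : {group {unit A}} := Group one_plus_group_set.

Definition double_orbit (g : {unit A}) : {set {unit A}} :=
  [set k : {unit A} | [exists x in algebra_group, exists y in algebra_group,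
     val k == 1 + val x * (val g - 1) * val y]].

Definition double_orbits : {set {set {unit A}}} :=
  [set double_orbit g | g in algebra_group].

(* For I an ideal of J, ann_mod I / I = Ann(J / I). *)
Definition ann_mod (I : {set A}) : {set A} :=
  [set x : A | (x \in idealv J) &&
     [forall y : A, (y \in idealv J) ==> (x * y \in I) && (y * x \in I)]].

Definition upper_annihilator (i : nat) : {set A} := iter i ann_mod [set 0].

End AlgebraGroup.

Record supercharacter_theory (gT : finGroupType) (G : {group gT}) :=
  SupercharacterTheory {
  char_parts : {set {set Iirr G}};
  superclasses : {set {set gT}};
  char_parts_partition : partition char_parts [set: Iirr G];
  superclasses_partition : partition superclasses G;
  superclass1 : [set 1%g] \in superclasses;
  card_char_parts : #|char_parts| = #|superclasses|;
  char_partsP : forall X, X \in char_parts ->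
    exists chi : 'CF(G),
      [/\ chi \is a character, chi != 0, {subset irr_constt chi <= X}
        & forall K, K \in superclasses -> {in K &, forall g h, chi g = chi h}]
}.

Definition double_orbit_theory (F : finFieldType) (J : nonUnitalAlgType F)
    (S : supercharacter_theory (algebra_group J)) : Prop :=
  superclasses S = double_orbits J.

(* A supercharacter theory is determined by its superclasses, and the notions
   below only involve these: they are defined for a partition cls of a group
   into superclasses.  In particular, if N is a union of superclasses then
   quo_classes cls N is the set of superclasses of the quotient theory by N. *)
Section CentralSeries.
Local Open Scope group_scope.

Definition super_class gT (cls : {set {set gT}}) (g : gT) : {set gT} :=
  pblock cls g.

Definition super_center (gT : finGroupType) (cls : {set {set gT}})
    (G : {set gT}) : {set gT} :=
  [set g in G | #|super_class cls g| == 1%N].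

Definition super_commg (gT : finGroupType) (cls : {set {set gT}})
    (H : {set gT}) : {set gT} :=
  <<[set g^-1 * k | g in H, k in super_class cls g]>>.

Definition quo_classes (gT : finGroupType) (cls : {set {set gT}})
    (N : {set gT}) : {set {set coset_of N}} :=
  [set K / N | K in cls].

Variables (gT : finGroupType) (G : {group gT}) (S : supercharacter_theory G).

(* The i-th term for i >= 1; the value at 0 is a dummy. *)
Definition lower_super_central (i : nat) : {set gT} :=
  iter i.-1 (super_commg (superclasses S)) G.

Fixpoint upper_super_central (i : nat) : {set gT} :=
  if i is i'.+1 then
    let Z := upper_super_central i' in
    coset Z @*^-1 super_center (quo_classes (superclasses S) Z) (G / Z)
  else 1.

End CentralSeries.

(* Main.v *)
Require Import Defs.
From HB Require Import structures.
From mathcomp Require Import all_boot all_order all_fingroup all_algebra.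
From mathcomp Require Import all_solvable all_field all_character.

(** Call a subgroup X of J that absorbs products with J an ideal.  Then
  1 + X is a normal subgroup of G, and two elements of G are congruent modulo
  1 + X exactly when their difference in A lies in X ([coset_one_plus]).  This
  turns both central series into computations with differences
    x (g - 1) y - (g - 1)   for x, y in G.
  With x = 1 or y = 1 they are (g - 1) b and b (g - 1), where b runs over J,
  and conversely every such difference is
    (x - 1) (g - 1) y + (g - 1) (y - 1).
  Hence the superclass of g is trivial modulo 1 + X if and only if g - 1
  annihilates J modulo X on both sides ([double_orbit_annihilates]).

  Upper series.  For X = Ann_i(J) this says that the central elements of the
  quotient theory of G / (1 + X) are the classes of 1 + Ann_{i+1}(J)
  ([card_quo_double_orbit], [upper_central_step]).

  Lower series.  Since J^i annihilates J modulo J^(i+1), the generators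
  g^-1 k of [1 + J^i, S] lie in 1 + J^(i+1).  For the converse, let
  k = 1 + (g - 1) (1 + b): then g^-1 k = 1 + (1 - g^-1) b, and 1 - g^-1 takes
  every value in J^i.  So the commutator subgroup contains all 1 + c b with c
  in J^i and b in J, and it contains 1 + sum_j a_j b_j because one more term is
  one more factor: if v is 1 plus a partial sum, then
  v + a b = v (1 + (v^-1 a) b), where v^-1 a is again in J^i
  ([super_commg_expv]). *)

Set Implicit Arguments.
Unset Strict Implicit.
Unset Printing Implicit Defensive.

Import GroupScope GRing.Theory.
Local Open Scope ring_scope.

(** The scalars in a linear combination of products u * v are absorbed by u, so
  that only sums of products need to be considered. *)
Lemma prodv_ind (K : fieldType) (aT : falgType K) (U V : {vspace aT})
    (P : aT -> Prop) :
    P 0 -> (forall z u v, P z -> u \in U -> v \in V -> P (z + u * v)) ->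
  forall z, z \in (U * V)%VS -> P z.
Proof.
move=> P0 PD z; rewrite [@prodv _ _]unlock.
rewrite -[X in <<X>>%VS]/(tval (in_tuple _)) => /coord_span->.
apply: big_rec => // i w _ Pw; rewrite addrC /=.
have /allpairsP[[u v] /= [Uu Vv ->]] := mem_nth 0 (ltn_ord i).
by rewrite scalerAl; apply: PD; rewrite // ?memvZ ?vbasis_mem.
Qed.

Section DoubleOrbitSeries.
Variables (F : finFieldType) (J : nonUnitalAlgType F).
Local Notation A := (finvect_type (adjoin1 J)).
Local Notation G := (algebra_group J).
Implicit Types (X : {pred A}) (x y : A) (g h k u v : {unit A}).

(** * Subgroups 1 + X and their cosets *)

Definition annihilates_mod X x : Prop :=
  forall y, y \in idealv J -> x * y \in X /\ y * x \in X.

(** A condition on predicates, in order to cover both the subspaces J^i and the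
  sets Ann_i(J). *)
Definition ideal_of X : Prop :=
  [/\ zmod_closed X, {subset X <= idealv J} &
      forall x, x \in X -> annihilates_mod X x].

Lemma ideal_ofD X x y : ideal_of X -> x \in X -> y \in X -> x + y \in X.
Proof. by case=> [[X0 XB] _ _] Xx Xy; rewrite -[y]opprK XB // -sub0r XB. Qed.

Lemma val_algebra_group g : g \in G -> val g - 1 \in idealv J.
Proof. by rewrite inE. Qed.

Lemma ideal_ofMr X x g : ideal_of X -> g \in G -> x \in X -> x * val g \in X.
Proof.
move=> idX Gg Xx; rewrite -[val g](subrK 1) mulrDr mulr1.
apply: ideal_ofD => //; case: idX => _ _ /(_ x Xx (val g - 1)).
by case/(_ (val_algebra_group Gg)).
Qed.

Lemma ideal_ofMl X x g : ideal_of X -> g \in G -> x \in X -> val g * x \in X.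
Proof.
move=> idX Gg Xx; rewrite -[val g](subrK 1) mulrDl mul1r.
apply: ideal_ofD => //; case: idX => _ _ /(_ x Xx (val g - 1)).
by case/(_ (val_algebra_group Gg)).
Qed.

(** Because u^-1 v - 1 = u^-1 (v - u) and X is stable under multiplication
  by u and by u^-1. *)
Lemma one_plus_mulVg X u v : ideal_of X -> u \in G ->
  (u^-1 * v \in one_plus X)%g = (val v - val u \in X).
Proof.
move=> idX Gu; rewrite inE FinRing.val_unitM.
have eB: val u^-1%g * (val v - val u) = val u^-1%g * val v - 1.
  by rewrite mulrBr -!FinRing.val_unitM mulVg FinRing.val_unit1.
rewrite -eB; apply/idP/idP => [|Xvu]; last by rewrite ideal_ofMl ?groupV.
move/(ideal_ofMl idX Gu); rewrite mulrA -FinRing.val_unitM mulgV.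
by rewrite FinRing.val_unit1 mul1r.
Qed.

Lemma one_plus_sub X : ideal_of X -> one_plus X \subset G.
Proof. by case=> _ sXJ _; apply/subsetP=> u; rewrite !inE => /sXJ. Qed.

Lemma one_plus_groupP X : ideal_of X -> group_set (one_plus X).
Proof.
move=> idX; have [[X0 _] _ _] := idX.
have X1: 1%g \in one_plus X by rewrite inE FinRing.val_unit1 subrr.
apply/group_setP; split=> // u v Xu Xv.
have Gv := subsetP (one_plus_sub idX) v Xv.
rewrite !inE in Xu Xv *; rewrite FinRing.val_unitM.
have ->: val u * val v - 1 = (val u - 1) * val v + (val v - 1).
  by rewrite mulrBl mul1r addrA subrK.
by rewrite ideal_ofD ?ideal_ofMr.
Qed.

Definition one_plus_group X (idX : ideal_of X) : {group {unit A}} :=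
  Group (one_plus_groupP idX).

Lemma one_plus_norm X : ideal_of X -> G \subset 'N(one_plus X).
Proof.
move=> idX; apply/subsetP=> g Gg; rewrite inE.
apply/subsetP=> _ /imsetP[u Xu ->].
have Gu := subsetP (one_plus_sub idX) u Xu.
rewrite conjgE one_plus_mulVg // FinRing.val_unitM.
have ->: val u * val g - val g = (val u - 1) * val g by rewrite mulrBl mul1r.
by move: Xu; rewrite inE; apply: ideal_ofMr.
Qed.

(** Left and right cosets of 1 + X agree by normality, so that
  [one_plus_mulVg] decides equality in the quotient. *)
Lemma coset_one_plus X u v (idX : ideal_of X) : u \in G -> v \in G ->
  (coset (one_plus X) u == coset (one_plus X) v) = (val u - val v \in X).
Proof.
move=> Gu Gv; have nXG := subsetP (one_plus_norm idX).
rewrite -(one_plus_mulVg _ idX Gv) -mem_lcoset.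
rewrite -[(v *: _)%g](@norm_rlcoset _ (one_plus_group idX) _ (nXG v Gv)).
have eP := @rcoset_kercosetP _ (one_plus_group idX) u v (nXG u Gu) (nXG v Gv).
by apply/eqP/eP.
Qed.

(** * Double orbits *)

Lemma double_orbitP g k :
  reflect (exists s t, [/\ s \in G, t \in G &
                           val k = 1 + val s * (val g - 1) * val t])
          (k \in double_orbit g).
Proof.
rewrite inE; apply: (iffP existsP) => [[s] | [s [t [Gs Gt e]]]].
  by case/andP=> Gs /existsP[t /andP[Gt /eqP e]]; exists s, t.
by exists s; rewrite Gs; apply/existsP; exists t; rewrite Gt e /=.
Qed.

Lemma double_orbit_id g : g \in double_orbit g.
Proof.
apply/double_orbitP; exists 1%g, 1%g; split=> //.
by rewrite FinRing.val_unit1 mul1r mulr1 addrC subrK.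
Qed.

Lemma idealv_mull x y : x \in idealv J -> x * y \in idealv J.
Proof.
by rewrite !mem_idealv; case: x y => [a x] [b y] /= /eqP->; rewrite mul0r.
Qed.

Lemma expv_idealv_subS i : (idealv J ^+ i.+2 <= idealv J ^+ i.+1)%VS.
Proof.
rewrite !(expvSr _ i.+1, expvSr _ i) -prodvA prodvSr //.
by apply/prodvP=> x y Jx _; apply: idealv_mull.
Qed.

Lemma expv_ideal_of i : (0 < i)%N -> ideal_of (idealv J ^+ i)%VS.
Proof.
case: i => // i _; split.
- by split=> [|x y]; [apply: mem0v | apply: memvB].
- move=> x; apply/subvP: x; elim: i => [|i]; first by rewrite expv1.
  exact/subv_trans/expv_idealv_subS.
move=> x Xx y Jy; split; apply: (subvP (expv_idealv_subS i)).
  by rewrite expvSr memv_mul.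
by rewrite expvSl memv_mul.
Qed.

Lemma idealv_ideal_of : ideal_of (idealv J).
Proof. exact: (@expv_ideal_of 1). Qed.

Lemma double_orbit_sub g : g \in G -> double_orbit g \subset G.
Proof.
move=> Gg; apply/subsetP=> k /double_orbitP[s [t [Gs Gt e]]].
rewrite inE e addrC addKr.
have idJ := idealv_ideal_of.
by rewrite (ideal_ofMr idJ) ?(ideal_ofMl idJ) ?val_algebra_group.
Qed.

Lemma ex_one_plus x : nilpotent_algebra J -> x \in idealv J ->
  exists2 u, u \in G & val u = 1 + x.
Proof.
move=> nilJ Jx; exists (FinRing.unit A (one_plus_unit nilJ Jx)) => //.
by rewrite inE /= addrC addKr.
Qed.

Lemma double_orbit_sym g k : k \in double_orbit g -> g \in double_orbit k.
Proof.
case/double_orbitP=> s [t [Gs Gt e]]; apply/double_orbitP.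
exists s^-1%g, t^-1%g; rewrite !groupV; split=> //.
rewrite [val k - 1]addrC e addKr !mulrA -FinRing.val_unitM mulVg.
rewrite FinRing.val_unit1 mul1r.
by rewrite -mulrA -FinRing.val_unitM mulgV FinRing.val_unit1 mulr1 addrC subrK.
Qed.

(** The elements of the class with s = 1 or t = 1 give the products of g - 1
  with J, and these account for all of s (g - 1) t - (g - 1).  Nilpotency
  provides an s in G with s - 1 = y for every y in J. *)
Lemma double_orbit_annihilates X g : nilpotent_algebra J -> ideal_of X ->
  g \in G ->
  (forall k, k \in double_orbit g -> val k - val g \in X)
    <-> annihilates_mod X (val g - 1).
Proof.
move=> nilJ idX Gg; split=> [Xg y Jy | Xg k].
  have [t Gt et] := ex_one_plus nilJ Jy.
  have idJ := idealv_ideal_of; have Ja := val_algebra_group Gg.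
  have [|k _ ek] := @ex_one_plus ((val g - 1) * val t) nilJ.
    by rewrite (ideal_ofMr idJ).
  have [|l _ el] := @ex_one_plus (val t * (val g - 1)) nilJ.
    by rewrite (ideal_ofMl idJ).
  have gk : k \in double_orbit g.
    by apply/double_orbitP; exists 1%g, t; rewrite ek FinRing.val_unit1 mul1r.
  have gl : l \in double_orbit g.
    by apply/double_orbitP; exists t, 1%g; rewrite el FinRing.val_unit1 mulr1.
  have := Xg l gl; have := Xg k gk; rewrite ek el et.
  rewrite mulrDr mulr1 [(1 + y) * _]mulrDl mul1r.
  by rewrite !addrA [1 + val g]addrC addrK ![val g + _]addrC !addrK.
case/double_orbitP=> s [t [Gs Gt ->]].
have ->: 1 + val s * (val g - 1) * val t - val g
       = (val s - 1) * (val g - 1) * val t + (val g - 1) * (val t - 1).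
  have eg: val g = 1 + (val g - 1) by rewrite addrC subrK.
  rewrite [X in _ - X]eg; move: (val g - 1) => a.
  rewrite opprD addrACA subrr add0r [_ * (_ - 1)]mulrBr mulr1.
  by rewrite !mulrBl mul1r addrA subrK.
apply: ideal_ofD => //; last first.
  by case: (Xg (val t - 1)); rewrite ?val_algebra_group.
by apply: ideal_ofMr => //; case: (Xg (val s - 1)); rewrite ?val_algebra_group.
Qed.

(** * The lower series *)

Lemma super_class_double_orbit (S : supercharacter_theory G) g :
  double_orbit_theory S -> g \in G ->
  super_class (superclasses S) g = double_orbit g.
Proof.
move=> doS Gg; have [_ tiS _] := and3P (superclasses_partition S).
apply: def_pblock tiS _ (double_orbit_id g); rewrite doS.
exact: imset_f.
Qed.

(** The inclusion from left to right says that J^i annihilates J modulo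
  J^(i+1).  Conversely, the commutator subgroup is stable under adding to an
  element a product a b with a in J^i and b in J, and such products span
  J^(i+1). *)
Lemma super_commg_expv (S : supercharacter_theory G) i :
  nilpotent_algebra J -> double_orbit_theory S -> (0 < i)%N ->
  super_commg (superclasses S) (one_plus (idealv J ^+ i)%VS)
    = one_plus (idealv J ^+ i.+1)%VS.
Proof.
move=> nilJ doS i_gt0; have idI := expv_ideal_of i_gt0.
have idI' := expv_ideal_of (ltn0Sn i).
have GI := subsetP (one_plus_sub idI).
rewrite /super_commg; set H := <<_>>%g.
have sHG' : H \subset one_plus (idealv J ^+ i.+1)%VS.
  rewrite -[one_plus _]/(gval (one_plus_group idI')) gen_subG.
  apply/subsetP=> _ /imset2P[g k Ig Kk ->] /=; have Gg := GI g Ig.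
  rewrite super_class_double_orbit // in Kk; rewrite one_plus_mulVg //.
  move: k Kk; apply/(double_orbit_annihilates nilJ idI' Gg).
  move: Ig; rewrite inE => Ig y Jy; rewrite [in X in X /\ _]expvSr expvSl.
  by rewrite !memv_mul.
apply/eqP; rewrite eqEsubset sHG' /=; apply/subsetP=> u; rewrite inE => Iu.
suff [v Hv ev] : exists2 v, v \in H & val v = 1 + (val u - 1).
  by have -> : u = v by apply/val_inj; rewrite ev addrC subrK.
move: Iu; rewrite expvSr; move: (val u - 1).
apply: prodv_ind => [|z a b [v Hv ev] Ia Jb].
  by exists 1%g; rewrite ?group1 // FinRing.val_unit1 addr0.
have Gv : v \in G by rewrite (subsetP (one_plus_sub idI')) ?(subsetP sHG').
(* As v + a b = v (1 + c b) with c = v^-1 a, it remains to obtain 1 + c b as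
   a generator g^-1 k: here g' = g^-1 = 1 - c. *)
set c := val v^-1%g * a.
have Ic : c \in (idealv J ^+ i)%VS by apply: ideal_ofMl; rewrite ?groupV.
have [_ sIJ _] := idI.
have [|g' Gg' eg'] := @ex_one_plus (- c) nilJ; first by rewrite memvN sIJ.
have Ig : g'^-1%g \in one_plus (idealv J ^+ i)%VS.
  apply: (@groupVr _ (one_plus_group idI)).
  by rewrite inE eg' addrC addKr memvN.
have [t Gt et] := ex_one_plus nilJ Jb.
have [|k _ ek] := @ex_one_plus ((val g'^-1%g - 1) * val t) nilJ.
  rewrite (ideal_ofMr idealv_ideal_of) //.
  by apply: sIJ; rewrite inE in Ig.
have Hgk : ((g'^-1)^-1 * k)%g \in H.
  apply: mem_gen; apply: imset2_f => //.
  rewrite super_class_double_orbit ?GI //.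
  by apply/double_orbitP; exists 1%g, t; rewrite FinRing.val_unit1 mul1r.
exists (v * ((g'^-1)^-1 * k))%g; first by rewrite groupM.
have egk : val ((g'^-1)^-1 * k)%g = 1 + c * b.
  rewrite invgK FinRing.val_unitM ek mulrDr mulr1 mulrA mulrBr mulr1.
  rewrite -FinRing.val_unitM mulgV FinRing.val_unit1 eg' et opprB.
  by rewrite [1 + (c - 1)]addrC subrK mulrDr mulr1 addrA subrK.
rewrite FinRing.val_unitM egk mulrDr mulr1 /c !mulrA -FinRing.val_unitM.
by rewrite mulgV FinRing.val_unit1 mul1r ev -addrA.
Qed.

(** * The upper series *)

Lemma mem_ann_mod (X : {set A}) x :
  reflect (x \in idealv J /\ annihilates_mod X x) (x \in ann_mod X).
Proof.
rewrite inE; apply: (iffP andP) => -[Jx Xx]; split=> //.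
  by move=> y Jy; have /forallP/(_ y)/implyP/(_ Jy)/andP := Xx.
by apply/forallP=> y; apply/implyP=> Jy; apply/andP; apply: Xx.
Qed.

Lemma ann_mod_sub (X : {set A}) : ideal_of X -> {subset X <= ann_mod X}.
Proof.
by case=> _ sXJ XJ x Xx; apply/mem_ann_mod; split; [apply: sXJ | apply: XJ].
Qed.

Lemma ann_mod_ideal_of (X : {set A}) : ideal_of X -> ideal_of (ann_mod X).
Proof.
move=> idX; have [[X0 XB] sXJ XJ] := idX; split.
- split=> [|x z /mem_ann_mod[Jx Xx] /mem_ann_mod[Jz Xz]].
    exact: ann_mod_sub.
  apply/mem_ann_mod; split=> [|y Jy]; first exact: memvB.
  have [[xy yx] [zy yz]] := (Xx y Jy, Xz y Jy).
  by rewrite mulrBl mulrBr !XB.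
- by move=> x /mem_ann_mod[].
move=> x /mem_ann_mod[Jx Xx] y Jy.
by case: (Xx y Jy); split; apply: ann_mod_sub.
Qed.

Lemma upper_annihilator_ideal_of i : ideal_of (upper_annihilator J i).
Proof.
elim: i => [|i IHi]; last exact: ann_mod_ideal_of.
split=> [|x|x]; rewrite ?inE.
- by split=> [|x y]; rewrite !inE ?eqxx // => /eqP-> /eqP->; rewrite subrr.
- by move/eqP->; rewrite mem0v.
by move/eqP-> => y _; rewrite mul0r mulr0 !inE.
Qed.

(** The class of the coset of u is computed as a block of [quo_classes] that
  contains this coset, hence as the image of the double orbit of some h that
  need not be u.  Both conditions imply that h is congruent to u modulo
  1 + X: the first directly, and the second because some k in the double orbit
  of h is congruent to u, so that k - 1 annihilates J modulo X and k has a
  trivial class, which contains h. *)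
Lemma card_quo_double_orbit (X : {set A}) u :
  nilpotent_algebra J -> ideal_of X -> u \in G ->
  (#|super_class (quo_classes (double_orbits J) (one_plus X))
       (coset (one_plus X) u)| == 1%N) = (val u - 1 \in ann_mod X).
Proof.
move=> nilJ idX Gu; set Z := one_plus X; set B := super_class _ _.
have nZG := subsetP (one_plus_norm idX).
have idA := ann_mod_ideal_of idX.
have memK h k : h \in G -> k \in double_orbit h ->
    coset Z k \in (double_orbit h / Z)%g.
  move=> Gh hk; apply: mem_morphim => //.
  by apply: nZG; apply: (subsetP (double_orbit_sub Gh)).
have uP : coset Z u \in cover (quo_classes (double_orbits J) Z).
  apply/bigcupP; exists (double_orbit u / Z)%g.
    by apply: imset_f; apply: imset_f.
  by rewrite memK ?double_orbit_id.
have Bu : coset Z u \in B by rewrite mem_pblock.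
have := pblock_mem uP; rewrite -/(super_class _ _) -/B.
case/imsetP=> _ /imsetP[h Gh ->] defB.
have dhG := subsetP (double_orbit_sub Gh).
apply/idP/idP => [/cards1P[z Bz] | Au].
  have Xk k : k \in double_orbit h -> val k - val u \in X.
    move=> hk; have Gk := dhG k hk; rewrite -(coset_one_plus idX) //.
    have := memK h k Gh hk; rewrite -defB Bz inE => /eqP->.
    by move: Bu; rewrite Bz inE eq_sym.
  have Xhu := Xk h (double_orbit_id h).
  have Ah : val h - 1 \in ann_mod X.
    apply/mem_ann_mod; split; first exact: val_algebra_group.
    apply/(double_orbit_annihilates nilJ idX Gh) => k hk.
    have [[_ XB] _ _] := idX; have := XB _ _ (Xk k hk) Xhu.
    by rewrite opprB addrA subrK.
  have [[_ AB] _ _] := idA; have := AB _ _ Ah (ann_mod_sub idX Xhu).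
  by rewrite opprB addrC addrA subrK.
have /morphimP[k nk hk eu] : coset Z u \in (double_orbit h / Z)%g.
  by rewrite -defB.
have Gk := dhG k hk.
have Xku : val k - val u \in X by rewrite -(coset_one_plus idX) //; apply/eqP.
have Ak : val k - 1 \in ann_mod X.
  have := ideal_ofD idA (ann_mod_sub idX Xku) Au.
  by rewrite addrA subrK.
have /mem_ann_mod[_ /(double_orbit_annihilates nilJ idX Gk) Xk] := Ak.
have Xhk := Xk h (double_orbit_sym hk).
have Ah : val h - 1 \in ann_mod X.
  have := ideal_ofD idA (ann_mod_sub idX Xhk) Ak.
  by rewrite addrA subrK.
have /mem_ann_mod[_ /(double_orbit_annihilates nilJ idX Gh) Xh] := Ah.
apply/cards1P; exists (coset Z h); apply/eqP.
rewrite defB eqEsubset sub1set memK ?double_orbit_id // andbT.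
apply/subsetP=> _ /morphimP[l nl hl ->]; have Gl := dhG l hl.
by rewrite inE coset_one_plus // Xh.
Qed.

(** With [card_quo_double_orbit], the only remaining point is that the preimage
  of G / (1 + X) is G itself, by normality. *)
Lemma upper_central_step (X : {set A}) :
  nilpotent_algebra J -> ideal_of X ->
  let Z := one_plus X in
  (coset Z @*^-1 super_center (quo_classes (double_orbits J) Z) (G / Z))%g
    = one_plus (ann_mod X).
Proof.
move=> nilJ idX Z; have idA := ann_mod_ideal_of idX.
have nZG := one_plus_norm idX.
have nsZG : (one_plus_group idX <| G)%g by rewrite /normal one_plus_sub.
rewrite /super_center setIdE morphpreI (quotientGK nsZG).
apply/setP=> u; rewrite inE; case Gu: (u \in G) => /=; last first.
  by apply/esym/negbTE; apply: contraFN Gu; apply: (subsetP (one_plus_sub idA)).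
rewrite in_setI (subsetP nZG) //= in_set in_set card_quo_double_orbit //.
by rewrite [RHS]inE.
Qed.

End DoubleOrbitSeries.

Theorem theorem35 (F : finFieldType) (J : nonUnitalAlgType F)
    (nilJ : nilpotent_algebra J)
    (S : supercharacter_theory (algebra_group J))
    (doS : double_orbit_theory S) :
  (forall i : nat, (1 <= i)%N ->
     lower_super_central S i = one_plus (idealv J ^+ i)%VS) /\
  (forall i : nat, upper_super_central S i = one_plus (upper_annihilator J i)).
Proof.
split=> [[|i] // _ | i].
  elim: i => [|i IHi]; first by rewrite expv1.
  by rewrite -(super_commg_expv nilJ doS) // -IHi.
elim: i => [|i IHi] /=.
  apply/setP=> u; rewrite !inE subr_eq0 -(inj_eq val_inj).
  by rewrite FinRing.val_unit1.
rewrite IHi doS; apply: upper_central_step => //.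
exact: upper_annihilator_ideal_of.
Qed.
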